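(* Let $(\mathcal R:A\to\mathsf{RR},X)$ be a hybrid dynamical system and let $(\{t_i\}_{i\ge 0},\varphi_0,\varphi_1,\{\sigma_i\}_{i\in\mathbb N})$ be an execution of it with jump times indexed by $\mathbb N$. Let $\mathcal T:\mathcal Z\to\mathsf{RR}$, equipped with the vector fields $\{\frac{d}{dt}|_{[t_{i-1},t_i]}\}_{i\in\mathbb N}$, be the hybrid dynamical system associated with the sequence $\{t_i\}$. Then, with $\varphi=(\varphi_0,\varphi_1)$, $$(\varphi,\{\sigma_i\}_{i\in\mathbb N}):\Bigl(\mathcal T:\mathcal Z\to\mathsf{RR},\ \bigl\{\tfrac{d}{dt}|_{[t_{i-1},t_i]}\bigr\}_{i\in\mathbb N}\Bigr)\to(\mathcal R:A\to\mathsf{RR},X)$$ is a map of hybrid dynamical systems.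
   Context: **Graphs.** A directed multigraph $A=\{A_1\rightrightarrows A_0\}$ consists of collections $A_0$ (nodes) and $A_1$ (arrows), not required to be sets, with source and target maps $\mathfrak s,\mathfrak t:A_1\to A_0$. A map of graphs $\varphi:A\to B$ is a pair of maps $\varphi_0:A_0\to B_0$, $\varphi_1:A_1\to B_1$ (both also written $\varphi$) commuting with source and target. **Regions.** A region is a manifold with corners. A map between manifolds with corners is smooth if it pulls back smooth functions to smooth functions (corners may be mapped to the interior). $Tf$ denotes the differential of $f$. A vector field on $D$ is a section of $TD\to D$. An integral curve of a vector field $X$ on $D$ is a smooth map $x:I\to D$ from an interval with $\frac{d}{dt}x=X(x(t))$ for all $t\in I$. **Relations.** A relation from a set $P$ to a set $Q$ is a subset of $Q\times P$ (note the order). **The graph $\mathsf{RR}$.** Its nodes are all manifolds with corners; its arrows from $P$ to $Q$ are all set-theoretic relations $R\subset Q\times P$. **Hybrid phase spaces.** A hybrid phase space is a map of graphs $\mathcal R:A\to\mathsf{RR}$. A map of hybrid phase spaces from $\mathcal R:A\to\mathsf{RR}$ to $\mathcal Q:B\to\mathsf{RR}$ is a pair $(\varphi,\{\alpha_a\}_{a\in A_0})$, where $\varphi:A\to B$ is a map of graphs and each $\alpha_a:\mathcal R(a)\to\mathcal Q(\varphi(a))$ is a smooth map of manifolds with corners, such that for each arrow $a_1\xrightarrow{\gamma}a_2$ of $A$, $$\{(\alpha_{a_2}(y),\alpha_{a_1}(x)) : (y,x)\in\mathcal R(\gamma)\}\subset\mathcal Q(\varphi(\gamma)).$$ **Hybrid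 dynamical systems.** A hybrid dynamical system is a pair $(\mathcal R:A\to\mathsf{RR},X)$ consisting of a hybrid phase space and a family $X=\{X_a\}_{a\in A_0}$ of vector fields, $X_a$ on $\mathcal R(a)$. A map of hybrid dynamical systems $(\mathcal R:A\to\mathsf{RR},X)\to(\mathcal Q:B\to\mathsf{RR},Y)$ is a map of hybrid phase spaces $(\varphi,\{\alpha_a\})$ with $Y_{\varphi(a)}\circ\alpha_a=T\alpha_a\circ X_a$ for all $a\in A_0$. **Executions with jump times indexed by $\mathbb N=\{0,1,2,\dots\}$.** An execution of $(\mathcal R:A\to\mathsf{RR},X)$ consists of: (1) a nondecreasing sequence $\{t_i\}_{i\ge0}$ of real numbers, together with some number $t_{-1}<t_0$; (2) a function $\varphi_0:\mathbb N\to A_0$; (3) a function $\varphi_1:\mathbb N\to A_1$ with $\mathfrak s(\varphi_1(i))=\varphi_0(i)$ and $\mathfrak t(\varphi_1(i))=\varphi_0(i+1)$ for all $i$; (4) for each $i\in\mathbb N$, an integral curve $\sigma_i:[t_{i-1},t_i]\to\mathcal R(\varphi_0(i))$ of $X_{\varphi_0(i)}$; (5) such that $(\sigma_{i+1}(t_i),\sigma_i(t_i))\in\mathcal R(\varphi_1(i))$ for all $i\in\mathbb N$. **The hybrid dynamical system associated with $\{t_i\}$.** $\mathcal Z$ is the graph with $\mathcal Z_0=\mathcal Z_1=\mathbb N$, $\mathfrak s(i)=i$, $\mathfrak t(i)=i+1$. The map of graphs $\mathcal T:\mathcal Z\to\mathsf{RR}$ is given on nodes by $\mathcal T(i)=[t_{i-1},t_i]$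 and on the arrow $i\xrightarrow{i}i+1$ by the one-point relation $\{(t_i,t_i)\}\subset[t_i,t_{i+1}]\times[t_{i-1},t_i]$. Each $[t_{i-1},t_i]$ carries the constant vector field $\frac{d}{dt}$. **Convention for degenerate intervals.** If $t_{i-1}=t_i$, any map from the one-point interval $[t_i,t_i]$ to a region is regarded as an integral curve of any vector field on that region. Correspondingly, for a map out of the system associated with $\{t_i\}$ the condition $T\sigma_i\circ\frac{d}{dt}=X_{\varphi(i)}\circ\sigma_i$ is imposed only at nodes $i$ with $t_{i-1}<t_i$. *)

(* Defs.v *)
From HB Require Import structures.
From mathcomp Require Import all_boot all_order all_algebra.
From mathcomp Require Import all_classical all_reals all_analysis.
From mathcomp Require Import ring lra.

Set Implicit Arguments.
Unset Strict Implicit.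
Unset Printing Implicit Defensive.
Import Order.TTheory GRing.Theory Num.Theory.
Import numFieldNormedType.Exports.

Local Open Scope classical_set_scope.
Local Open Scope ring_scope.

(** * Smooth functions on open subsets of R^n *)

(* [V] is meant to be open: all derivatives are taken in the whole of R^n. *)
Fixpoint Ck (R : realType) (n k : nat) (V : set 'rV[R]_n) (g : 'rV[R]_n -> R) :
    Prop :=
  match k with
  | 0 => forall x, V x -> {for x, continuous g}
  | k'.+1 => [/\ forall x, V x -> {for x, continuous g},
                 forall (i : 'I_n) x, V x -> derivable g x (delta_mx 0 i)
               & forall i : 'I_n, Ck k' V ('D_(delta_mx 0 i) g)]
  end.

Definition smooth_on (R : realType) (n : nat) (V : set 'rV[R]_n)
    (g : 'rV[R]_n -> R) : Prop := forall k, Ck k V g.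

Section SmoothOn.
Context {R : realType} {n : nat}.
Implicit Types (V W : set 'rV[R]_n) (f g : 'rV[R]_n -> R).

Lemma Ck_cts k V g x : Ck k V g -> V x -> {for x, continuous g}.
Proof. by case: k => [H /H|k [H _ _] /H]. Qed.

Lemma Ck_pred k V g : Ck k.+1 V g -> Ck k V g.
Proof.
elim: k g => [|k IH] g; first by case.
by move=> [cg dg Cg]; split=> // i; exact: IH (Cg i).
Qed.

Lemma Ck_eq k V f g : open V -> {in V, f =1 g} -> Ck k V f -> Ck k V g.
Proof.
move=> oV; elim: k f g => [|k IH] f g fg.
all: have nfg x : V x -> {near x, f =1 g}
  by move=> Vx; near=> y; apply: fg; apply/mem_set; near: y;
     exact: open_nbhs_nbhs.
all: have cts : (forall x, V x -> {for x, continuous f}) ->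
    forall x, V x -> {for x, continuous g}
  by move=> cf x Vx; rewrite /prop_for /continuous_at -(fg x) ?inE//;
     exact: cvg_trans (near_eq_cvg (nfg x Vx)) (cf x Vx).
  exact: cts.
move=> [cf df Cf]; split; first exact: cts.
- by move=> i x Vx; apply: (near_eq_derivable (f := f)); [exact: nfg|exact: df].
- move=> i; apply: IH (Cf i) => x /set_mem Vx.
  by apply: near_eq_derive; exact: nfg.
Unshelve. all: by end_near. Qed.

Lemma Ck_sub k V W g : W `<=` V -> Ck k V g -> Ck k W g.
Proof.
move=> WV; elim: k g => [g Cg x /WV|k IH g [cg dg Cg]]; first exact: Cg.
by split=> [x /WV|i x Wx|i]; [exact: cg|exact: (dg _ _ (WV _ Wx))|exact: IH (Cg i)].
Qed.

Lemma Ck_cst k V (c : R) : Ck k V (cst c).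
Proof.
elim: k c => [c x _|k IH c]; first exact: cst_continuous.
split=> [x _|i x _|i]; [exact: cst_continuous|exact: derivable_cst|].
rewrite (_ : 'D_(delta_mx 0 i) (cst c) = cst 0); first exact: IH.
by apply/funext => x /=; rewrite derive_cst.
Qed.

Lemma CkD k V f g : open V -> Ck k V f -> Ck k V g -> Ck k V (f \+ g).
Proof.
move=> oV; elim: k f g => [f g Cf Cg x Vx|k IH f g Cf Cg].
  by exact: continuousD (Cf x Vx) (Cg x Vx).
split=> [x Vx|i x Vx|i].
- by exact: continuousD (Ck_cts Cf Vx) (Ck_cts Cg Vx).
- by case: Cf Cg => [_ df _] [_ dg _]; exact: derivableD (df i x Vx) (dg i x Vx).
- case: Cf Cg => [_ df Cf] [_ dg Cg].
  apply: Ck_eq oV _ (IH _ _ (Cf i) (Cg i)) => x /set_mem Vx.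
  exact: esym (deriveD (df i x Vx) (dg i x Vx)).
Qed.

Lemma CkM k V f g : open V -> Ck k V f -> Ck k V g -> Ck k V (f \* g).
Proof.
move=> oV; elim: k f g => [f g Cf Cg x Vx|k IH f g Cf Cg].
  by exact: continuousM (Cf x Vx) (Cg x Vx).
split=> [x Vx|i x Vx|i].
- by exact: continuousM (Ck_cts Cf Vx) (Ck_cts Cg Vx).
- by case: Cf Cg => [_ df _] [_ dg _]; exact: derivableM (df i x Vx) (dg i x Vx).
- have [Cf' Cg'] := (Ck_pred Cf, Ck_pred Cg).
  case: Cf Cg => [_ df Cf] [_ dg Cg].
  apply: Ck_eq oV _ (CkD oV (IH _ _ Cf' (Cg i)) (IH _ _ Cg' (Cf i))).
  move=> x /set_mem Vx; exact: esym (deriveM (df i x Vx) (dg i x Vx)).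
Qed.

Lemma is_derive_coord (x v : 'rV[R]_n) (i : 'I_n) :
  is_derive x v (fun w : 'rV[R]_n => w 0 i : R) (v 0 i).
Proof.
have H : (fun h : R => h^-1 *: (((fun w : 'rV[R]_n => w 0 i : R) \o shift x)
    (h *: v) - x 0 i)) @ 0^' --> v 0 i.
  apply: cvg_near_cst; near=> h.
  rewrite /= !mxE addrK /GRing.scale /= mulrA mulVf ?mul1r//.
  by near: h; exact: nbhs_dnbhs_neq.
apply: DeriveDef; first by apply/cvg_ex; exists (v 0 i).
exact: cvg_lim H.
Unshelve. all: by end_near. Qed.

Lemma smooth_on_coord V (i : 'I_n) : smooth_on V (fun v => v 0 i).
Proof.
case=> [x _|k]; first exact: coord_continuous.
split=> [x _|j x _|j]; first exact: coord_continuous.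
  by have := is_derive_coord x (delta_mx 0 j) i; case.
have -> : 'D_(delta_mx 0 j) (fun v : 'rV[R]_n => v 0 i : R) =
    cst ((delta_mx 0 j : 'rV[R]_n) 0 i); last exact: Ck_cst.
by apply/funext => x; exact: (@derive_val _ _ _ _ _ _ _ (is_derive_coord x _ i)).
Qed.

End SmoothOn.

(** * Manifolds with corners *)

(* The local model [0, +oo)^k x R^(n - k). *)
Definition corner (R : realType) (n k : nat) : set 'rV[R]_n :=
  [set v | forall i : 'I_n, (i < k)%N -> 0 <= v 0 i].
Arguments corner {R n} k.

(* A homeomorphism from the open set [chart_dom] onto a relatively open subset
   of a local model; the values of [chart_fun] outside [chart_dom] are
   irrelevant. *)
Record chart (R : realType) (M : topologicalType) (n : nat) := Chart {
  chart_dom : set M;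
  chart_fun :> M -> 'rV[R]_n;
  chart_corner : nat;
  chart_corner_le : (chart_corner <= n)%N;
  chart_dom_open : open chart_dom;
  chart_cts : forall p, chart_dom p -> {for p, continuous chart_fun};
  chart_inj : set_inj chart_dom chart_fun;
  chart_img : forall W, open W -> W `<=` chart_dom ->
    exists2 V, open V & chart_fun @` W = V `&` corner chart_corner
}.

(* [f \o c^-1], defined on the subset [c @` (D `&` chart_dom c)] of a local
   model, extends near [c p] to a smooth function on an open subset of R^n. *)
Definition smooth_at (R : realType) (M : topologicalType) (n : nat)
    (c : chart R M n) (D : set M) (f : M -> R) (p : M) : Prop :=
  exists V g, [/\ open V, V (c p), smooth_on V g &
    forall q, chart_dom c q -> D q -> V (c q) -> f q = g (c q)].

Record region (R : realType) := Region {
  region_space :> topologicalType;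
  dim : nat;
  atlas : set (chart R region_space dim);
  region_hausdorff : hausdorff_space region_space;
  region_second_countable : @second_countable region_space;
  atlas_cover : forall p, exists2 c, atlas c & chart_dom c p;
  (* the coordinates of the transition maps [c' \o c^-1] are smooth *)
  atlas_compat : forall c c', atlas c -> atlas c' ->
    forall p (i : 'I_dim), chart_dom c p -> chart_dom c' p ->
    smooth_at c (chart_dom c') (fun q => c' q 0 i) p
}.
Arguments atlas {R} r _.
Arguments dim {R} r.

Definition smooth_fun (R : realType) (M : region R) (f : M -> R) : Prop :=
  forall c, atlas M c -> forall p, chart_dom c p -> smooth_at c setT f p.

Definition smooth_map (R : realType) (M N : region R) (f : M -> N) : Prop :=
  forall g : N -> R, smooth_fun g -> smooth_fun (g \o f).

Lemma smooth_fun_cts (R : realType) (M : region R) (f : M -> R) :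
  smooth_fun f -> continuous f.
Proof.
move=> sf p; have [c Ac cp] := atlas_cover p.
have [V [g [oV Vp sg fg]]] := sf c Ac p cp.
have cg : {for p, continuous (g \o c)}.
  by apply: continuous_comp; [exact: chart_cts|exact: Ck_cts (sg 0) Vp].
rewrite /continuous_at (fg p cp I Vp).
apply: cvg_trans cg; apply: near_eq_cvg; near=> q.
apply/esym/fg => //; near: q.
  by apply: open_nbhs_nbhs; split=> //; exact: chart_dom_open.
by apply: (chart_cts cp); exact: open_nbhs_nbhs.
Unshelve. all: by end_near. Qed.

(** * The algebra C^oo(M) *)

Record Cinf (R : realType) (M : region R) := SmoothFun {
  Cinf_fun :> M -> R;
  Cinf_smooth : smooth_fun Cinf_fun
}.

Section CinfAlgebra.
Context {R : realType} {M : region R}.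

Lemma Cinf_eq (f g : Cinf M) : f =1 g -> f = g.
Proof.
case: f g => [f sf] [g sg] /= /funext fg; rewrite fg in sf *.
by congr SmoothFun; exact: Prop_irrelevance.
Qed.

Lemma smooth_fun_cst (a : R) : smooth_fun (cst a : M -> R).
Proof.
move=> c _ p _; exists setT, (cst a); split=> //; first exact: openT.
by move=> k; exact: Ck_cst.
Qed.

Let smooth_fun_op (op : R -> R -> R)
    (opk : forall n k (V : set 'rV[R]_n) g h, open V -> Ck k V g -> Ck k V h ->
      Ck k V (fun v => op (g v) (h v))) (f g : M -> R) :
  smooth_fun f -> smooth_fun g -> smooth_fun (fun p => op (f p) (g p)).
Proof.
move=> sf sg c Ac p cp.
have [V [f' [oV Vp sf' ff']]] := sf c Ac p cp.
have [W [g' [oW Wp sg' gg']]] := sg c Ac p cp.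
exists (V `&` W), (fun v => op (f' v) (g' v)); split=> //; first exact: openI.
- move=> k; apply: opk; first exact: openI.
  + by apply: Ck_sub (sf' k) => ? [].
  + by apply: Ck_sub (sg' k) => ? [].
- by move=> q cq _ [Vq Wq]; rewrite ff' ?gg'.
Qed.

Lemma smooth_funD (f g : M -> R) :
  smooth_fun f -> smooth_fun g -> smooth_fun (f \+ g).
Proof. by apply: smooth_fun_op => n k V ? ?; exact: CkD. Qed.

Lemma smooth_funM (f g : M -> R) :
  smooth_fun f -> smooth_fun g -> smooth_fun (f \* g).
Proof. by apply: smooth_fun_op => n k V ? ?; exact: CkM. Qed.

Definition Cinf_add (f g : Cinf M) : Cinf M :=
  SmoothFun (smooth_funD (Cinf_smooth f) (Cinf_smooth g)).

Definition Cinf_mul (f g : Cinf M) : Cinf M :=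
  SmoothFun (smooth_funM (Cinf_smooth f) (Cinf_smooth g)).

Definition Cinf_scale (a : R) (f : Cinf M) : Cinf M :=
  SmoothFun (smooth_funM (smooth_fun_cst a) (Cinf_smooth f)).

End CinfAlgebra.

Definition pullback (R : realType) (M N : region R) (f : M -> N)
    (sf : smooth_map f) (g : Cinf N) : Cinf M :=
  SmoothFun (sf g (Cinf_smooth g)).

(** * Tangent vectors, differentials and vector fields *)

(* T_p M, as the space of derivations of C^oo(M) at [p]. *)
Record tangent (R : realType) (M : region R) (p : M) := Tangent {
  tangent_fun :> Cinf M -> R;
  tangentD : forall f g,
    tangent_fun (Cinf_add f g) = tangent_fun f + tangent_fun g;
  tangentZ : forall a f, tangent_fun (Cinf_scale a f) = a * tangent_fun f;
  tangentM : forall f g,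
    tangent_fun (Cinf_mul f g) = f p * tangent_fun g + g p * tangent_fun f
}.

Lemma tangent_eq (R : realType) (M : region R) (p : M) (v w : tangent p) :
  v =1 w -> v = w.
Proof.
case: v w => [v vD vZ vM] [w wD wZ wM] /= /funext vw.
rewrite vw in vD vZ vM *.
by congr Tangent; exact: Prop_irrelevance.
Qed.

Section Differential.
Context {R : realType} {M N : region R} {f : M -> N} (sf : smooth_map f).
Context {p : M} (v : tangent p).

Let push (g : Cinf N) : R := v (pullback sf g).

Let pushD g h : push (Cinf_add g h) = push g + push h.
Proof. by rewrite /push -tangentD; congr (v _); exact: Cinf_eq. Qed.

Let pushZ a g : push (Cinf_scale a g) = a * push g.
Proof. by rewrite /push -tangentZ; congr (v _); exact: Cinf_eq. Qed.

Let pushM g h : push (Cinf_mul g h) = g (f p) * push h + h (f p) * push g.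
Proof.
rewrite /push -[g (f p)]/(pullback sf g p) -[h (f p)]/(pullback sf h p).
by rewrite -tangentM; congr (v _); exact: Cinf_eq.
Qed.

Definition differential : tangent (f p) := Tangent pushD pushZ pushM.

End Differential.

Record vector_field (R : realType) (M : region R) := VectorField {
  vf_at :> forall p : M, tangent p;
  vf_smooth : forall f : Cinf M, smooth_fun (fun p => vf_at p f)
}.

(** * The interval [a, b] as a region *)

Section Interval.
Context {R : realType}.
Variables a b : R.

Definition itv_space : topologicalType := set_type (`[a, b]%classic : set R).

Lemma itv_spaceP (q : itv_space) : a <= \val q <= b.
Proof. by case: q => x /= /set_mem; rewrite /= in_itv. Qed.

Lemma itv_point_subproof (x : R) : a <= x <= b -> x \in `[a, b]%classic.
Proof. by move=> axb; apply/mem_set; rewrite /= in_itv. Qed.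

Definition itv_point (x : R) (axb : a <= x <= b) : itv_space :=
  exist _ x (itv_point_subproof axb).

Lemma itv_val_cts : continuous (\val : itv_space -> R).
Proof. by rewrite -set_valE; exact: initial_continuous. Qed.

Lemma itv_openP (W : set itv_space) : open W ->
  exists2 A : set R, open A & W = \val @^-1` A.
Proof. by case=> A oA <-; exists A => //; rewrite set_valE. Qed.

Lemma itv_hausdorff : hausdorff_space itv_space.
Proof.
move=> p q pq; apply: val_inj; apply: Rhausdorff => A B pA qB.
have [r [Ar Br]] := pq _ _ (itv_val_cts pA) (itv_val_cts qB).
by exists (\val r).
Qed.

Lemma itv_second_countable : @second_countable itv_space.
Proof.
pose B (pq : rat * rat) : set itv_space :=
  \val @^-1` `]ratr pq.1, ratr pq.2[%classic.
exists (range B).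
  exact: card_le_trans (card_image_le _ _) (countableP _).
split=> [_ [pq _ <-]|x W].
  by apply: open_comp (interval_open _ _) => // q _; exact: itv_val_cts.
rewrite nbhsE => -[U [oU Ux] UW]; have [A oA UE] := itv_openP oU; have Ax : A (\val x) by move: Ux; rewrite UE.
have /nbhs_ballP [e /= e0 xeA] : nbhs (\val x) A by exact: open_nbhs_nbhs.
have [p] : exists p : rat, ratr p \in `]\val x - e, \val x[.
  by apply: rat_in_itvoo; rewrite ltrBlDr ltrDl.
have [q] : exists q : rat, ratr q \in `]\val x, \val x + e[.
  by apply: rat_in_itvoo; rewrite ltrDl.
rewrite !in_itv /= => /andP[xq qe] /andP[ep px].
exists (B (p, q)); first by split; [exists (p, q)|rewrite /B /= in_itv /= px].
move=> r; rewrite /B /= in_itv /= => /andP[pr rq]; apply: UW; rewrite UE; apply: xeA.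
rewrite /ball /= ltr_distl ltrBlDr (lt_trans rq qe) -ltrBlDr.
exact: lt_trans ep pr.
Qed.

(* The dimension is 1 if [a < b] and 0 otherwise.  If [a < b], the two charts
   are [q |-> q - a] on [a, b) and [q |-> b - q] on (a, b]; otherwise both are
   the map to the point R^0. *)
Definition itv_dim : nat := (a < b)%R.

Definition itv_chart_dom (s : bool) : set itv_space :=
  [set q | a < b -> if s then \val q < b else a < \val q].

Definition itv_chart_fun (s : bool) (q : itv_space) : 'rV[R]_itv_dim :=
  const_mx (if s then \val q - a else b - \val q).

Lemma itv_dim_lt (i : 'I_itv_dim) : a < b.
Proof. by case: i => m; rewrite /itv_dim; case: (a < b). Qed.

Lemma itv_dim_eq (i j : 'I_itv_dim) : i = j.
Proof.
apply: ord_inj; case: i j => [m im] [l jl] /=.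
by move: im jl; rewrite /itv_dim; case: (a < b) => //; case: m l => [|m] [|l].
Qed.

Lemma itv_dim_ord : a < b -> 'I_itv_dim.
Proof. by move=> ab; exists 0; rewrite /itv_dim ab. Qed.

Lemma itv_dim0 (ab : ~~ (a < b)) (v w : 'rV[R]_itv_dim) : v = w.
Proof. by apply/rowP => i; rewrite (itv_dim_lt i) in ab. Qed.

Lemma itv_chart_dom_open s : open (itv_chart_dom s).
Proof.
have [ab|ab] := boolP (a < b); last first.
  rewrite (_ : itv_chart_dom s = setT); first exact: openT.
  by apply/seteqP; split=> // q _; rewrite /itv_chart_dom /= (negbTE ab).
rewrite (_ : itv_chart_dom s =
    \val @^-1` (if s then `]-oo, b[%classic else `]a, +oo[%classic)).
  apply: open_comp; first by move=> q _; exact: itv_val_cts.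
  by case: s; exact: interval_open.
apply/seteqP; split=> q; rewrite /itv_chart_dom /=.
  by move=> /(_ ab); case: s => /=; rewrite in_itv /= ?andbT.
by case: s => /=; rewrite in_itv /= ?andbT.
Qed.

Lemma itv_chart_cts s p : itv_chart_dom s p ->
  {for p, continuous (itv_chart_fun s)}.
Proof.
move=> _; have c1 : {for p, continuous (fun q : itv_space =>
    if s then \val q - a else b - \val q)}.
  have cv : \val @ p --> (\val p : R) := @itv_val_cts p.
  by case: s; [exact: cvgB cv (cvg_cst _)|exact: cvgB (cvg_cst _) cv].
move=> W [P Pp PW]; suff : \near p, W (itv_chart_fun s p) by [].
have [ab|ab] := boolP (a < b); last first.
  near=> q; rewrite (itv_dim0 ab (itv_chart_fun s q) (itv_chart_fun s p)).
  by apply: PW => i j; exact: nbhs_singleton.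
near=> q; apply: PW => i j; rewrite mxE (ord1 i) (itv_dim_eq j (itv_dim_ord ab)).
near: q; apply: c1; have := Pp 0 (itv_dim_ord ab); by rewrite mxE.
Unshelve. all: by end_near. Qed.

Lemma itv_chart_inj s : set_inj (itv_chart_dom s) (itv_chart_fun s).
Proof.
move=> p q _ _ pq; apply: val_inj; have [ab|ab] := boolP (a < b).
  have := congr1 (fun v : 'rV[R]_itv_dim => v 0 (itv_dim_ord ab)) pq.
  by rewrite !mxE; case: s {pq} => [/addIr|/subrI].
have := itv_spaceP q; have := itv_spaceP p; rewrite -leNgt in ab.
move=> /andP[ap pb] /andP[aq qb]; apply/le_anti/andP.
by split; [exact: le_trans pb (le_trans ab aq)|exact: le_trans qb (le_trans ab ap)].
Qed.

Lemma itv_chart_img s W : open W -> W `<=` itv_chart_dom s ->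
  exists2 V, open V & itv_chart_fun s @` W = V `&` corner itv_dim.
Proof.
move=> oW Wdom; have [ab|ab] := boolP (a < b); last first.
  have cT (v : 'rV[R]_itv_dim) : corner itv_dim v by move=> i; rewrite (itv_dim_lt i) in ab.
  have [[q Wq]|W0] := pselect (exists q, W q).
    exists setT; first exact: openT.
    rewrite setTI; apply/seteqP; split=> v _ //.
    by exists q => //; exact: itv_dim0.
  exists set0; first exact: open0.
  by rewrite set0I; apply/seteqP; split=> v // -[q Wq]; case: W0; exists q.
have [A oA WE] := itv_openP oW; pose i0 := itv_dim_ord ab.
pose inv (r : R) := if s then a + r else b - r.
have inv_cts : continuous inv.
  move=> r; rewrite /inv; case: s {Wdom inv}.
    exact: cvgD (cvg_cst _) cvg_id.
  exact: cvgB (cvg_cst _) cvg_id.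
pose P : set R := (inv @^-1` A) `&` `]-oo, b - a[%classic.
have oP : open P by apply: openI => //; apply: open_comp => // r _; exact: inv_cts.
exists ((fun v : 'rV[R]_itv_dim => v 0 i0) @^-1` P).
  by apply: open_comp => // v _; exact: coord_continuous.
apply/seteqP; split=> [_ [q Wq <-]|v [[/= Av vlt] cv]].
  have dq := Wdom q Wq ab; have Aq : A (\val q) by move: Wq; rewrite WE.
  have := itv_spaceP q; split; last first.
    by move=> i _; rewrite mxE; case: s {Wdom inv inv_cts P oP} dq; lra.
  rewrite /P /inv /= in_itv /= mxE; case: s {Wdom inv inv_cts P oP} dq => dq.
    by rewrite addrC subrK; split=> //; lra.
  by rewrite subKr; split=> //; lra.
have v0 : 0 <= v 0 i0 by apply: cv; exact: ltn_ord.
rewrite in_itv /= in vlt.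
have ab' : a <= inv (v 0 i0) <= b by rewrite /inv; case: (s); lra.
exists (itv_point ab'); first by rewrite WE.
apply/rowP => i; rewrite mxE (itv_dim_eq i i0) /= /inv.
by case: (s); lra.
Qed.

Definition itv_chart (s : bool) : chart R itv_space itv_dim :=
  Chart (leqnn itv_dim) (itv_chart_dom_open s) (@itv_chart_cts s)
    (@itv_chart_inj s) (@itv_chart_img s).

Lemma itv_atlas_cover p :
  exists2 c, range itv_chart c & chart_dom c p.
Proof.
have [pb|pb] := boolP (\val p < b).
  by exists (itv_chart true); [exists true|].
exists (itv_chart false); first by exists false.
by move=> ab; rewrite -leNgt in pb; exact: lt_le_trans ab pb.
Qed.

Lemma itv_atlas_compat c c' : range itv_chart c -> range itv_chart c' ->
  forall p (i : 'I_itv_dim), chart_dom c p -> chart_dom c' p ->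
  smooth_at c (chart_dom c') (fun q => c' q 0 i) p.
Proof.
move=> [s _ <-] [s' _ <-] p i _ _; exists setT.
exists (if s == s' then fun v => v 0 i
        else cst (b - a) \+ (cst (- 1) \* (fun v => v 0 i))).
split=> //; first exact: openT.
- case: ifP => _; first exact: smooth_on_coord.
  move=> k; apply: CkD openT (Ck_cst _ _ _) _.
  exact: CkM openT (Ck_cst _ _ _) (smooth_on_coord _ _ _).
- by move=> q _ _ _; case: s s' => [] [] /=; rewrite !mxE //; ring.
Qed.

Definition itv_region : region R :=
  Region itv_hausdorff itv_second_countable itv_atlas_cover itv_atlas_compat.
End Interval.

(** * The vector field d/dt on [a, b] *)

Section Ddt.
Context {R : realType}.
Variables a b : R.
Local Notation I := (itv_region a b).

Lemma itv_dnbhs_proper (ab : a < b) (q : I) : ProperFilter q^'.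
Proof.
apply: Build_ProperFilter_ex => P; rewrite /dnbhs /within /=.
rewrite nbhsE => -[U [oU Uq] UP]; have [A oA UE] := itv_openP oU.
have /nbhs_ballP [e /= e0 eA] : nbhs (\val q) A.
  by apply: open_nbhs_nbhs; split=> //; move: Uq; rewrite UE.
have /andP[aq qb] := itv_spaceP q.
suff [r arb [rq re]] : exists2 r : R, a <= r <= b & r != \val q /\ `|\val q - r| < e.
  exists (itv_point arb); refine (UP (itv_point arb) _ _).
    by rewrite UE; exact: eA.
  by apply/eqP => Eq; move/eqP: rq; apply; rewrite -Eq.
have [qb'|bq] := ltP (\val q) b.
  have [m0 m1] : 0 < Num.min (e / 2) (b - \val q) /\ Num.min (e / 2) (b - \val q) <= b - \val q.
    by rewrite lt_min ge_min lexx orbT divr_gt0// subr_gt0 qb'.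
  have m2 : Num.min (e / 2) (b - \val q) <= e / 2 by rewrite ge_min lexx.
  set m := Num.min _ _ in m0 m1 m2; exists (\val q + m).
    by rewrite -lerBrDl m1 andbT ler_wpDr// ltW.
  split; first by rewrite -subr_eq0 addrC addKr gt_eqF.
  by rewrite opprD addrA subrr sub0r normrN gtr0_norm//; lra.
have [m0 m1] : 0 < Num.min (e / 2) (b - a) /\ Num.min (e / 2) (b - a) <= b - a.
  by rewrite lt_min ge_min lexx orbT divr_gt0// subr_gt0 ab.
have m2 : Num.min (e / 2) (b - a) <= e / 2 by rewrite ge_min lexx.
set m := Num.min _ _ in m0 m1 m2; exists (b - m); first by lra.
have -> : \val q = b by apply/le_anti; rewrite qb bq.
split; first by rewrite -subr_eq0 addrC addKr oppr_eq0 gt_eqF.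
by rewrite subKr gtr0_norm//; lra.
Qed.

Definition ddt_fun (f : I -> R) (q : I) : R :=
  if a < b then lim ((f r - f q) / (\val r - \val q) @[r --> q^']) else 0.

Let sgn (s : bool) : R := if s then 1 else - 1.

Lemma ddt_chart_cvg (ab : a < b) s (f : I -> R) V g (q : I) :
  open V -> Ck 1 V g ->
  (forall r, chart_dom (itv_chart a b s) r -> setT r -> V (itv_chart a b s r) ->
    f r = g (itv_chart a b s r)) ->
  chart_dom (itv_chart a b s) q -> V (itv_chart a b s q) ->
  (f r - f q) / (\val r - \val q) @[r --> q^'] -->
    sgn s * 'D_(delta_mx 0 (itv_dim_ord ab)) g (itv_chart a b s q).
Proof.
set c := itv_chart a b s; set e := delta_mx _ _ => oV [_ dg _] fg dq Vq.
pose h (r : I) := sgn s * (\val r - \val q).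
have ss : sgn s * sgn s = 1 by rewrite /sgn; case: (s); rewrite ?mulrNN mulr1.
have s0 : sgn s != 0 by rewrite /sgn; case: (s); rewrite ?oppr_eq0 oner_neq0.
have cv : \val @ q --> (\val q : R) := @itv_val_cts _ a b q.
have hcvg : h @ q^' --> 0^'.
  have h0 : h @ q --> (0 : R).
    rewrite -(mulr0 (sgn s)) -(subrr (\val q)).
    exact: cvgM (cvg_cst _) (cvgB cv (cvg_cst _)).
  move=> P P0; have {}P0 : \forall r \near q, h r != 0 -> P (h r) := h0 _ P0.
  suff : \forall r \near q, r != q -> P (h r) by [].
  near=> r => rq; have : h r != 0 -> P (h r) by near: r.
  apply; rewrite mulf_neq0// subr_eq0; apply/eqP => /val_inj rq'.
  by rewrite rq' eqxx in rq.
have ce r : c r = h r *: e + c q.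
  apply/rowP => i; rewrite !mxE (itv_dim_eq i (itv_dim_ord ab)) !eqxx mulr1.
  by rewrite /h /sgn; case: (s); ring.
have key : (fun r => sgn s * ((h r)^-1 *: (g (h r *: e + c q) - g (c q)))) @ q^'
    --> sgn s * 'D_e g (c q).
  apply: cvgM; first exact: cvg_cst.
  have := dg (itv_dim_ord ab) (c q) Vq.
  exact: (cvg_comp _ _ hcvg).
apply: cvg_trans key; apply: near_eq_cvg; near=> r.
have dr : chart_dom c r.
  near: r; apply: nbhs_dnbhs; apply: open_nbhs_nbhs.
  by split=> //; exact: chart_dom_open.
have Vr : V (c r).
  near: r; apply: nbhs_dnbhs; apply: (chart_cts dq).
  exact: open_nbhs_nbhs.
rewrite -ce (fg r dr Logic.I Vr) (fg q dq Logic.I Vq) /GRing.scale /=.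
rewrite /h invfM mulrA mulrA mulfV// mul1r mulrC.
by [].
Unshelve. all: by end_near. Qed.

Lemma ddt_chartE (ab : a < b) s (f : I -> R) V g (q : I) :
  open V -> Ck 1 V g ->
  (forall r, chart_dom (itv_chart a b s) r -> setT r -> V (itv_chart a b s r) ->
    f r = g (itv_chart a b s r)) ->
  chart_dom (itv_chart a b s) q -> V (itv_chart a b s q) ->
  ddt_fun f q =
    sgn s * 'D_(delta_mx 0 (itv_dim_ord ab)) g (itv_chart a b s q).
Proof.
move=> oV Cg fg dq Vq; rewrite /ddt_fun ab.
have PF := itv_dnbhs_proper ab q.
exact (cvg_lim (@Rhausdorff R) (ddt_chart_cvg (ab := ab) oV Cg fg dq Vq)).
Qed.

Lemma ddt_cvg (ab : a < b) (f : I -> R) (q : I) : smooth_fun f ->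
  (f r - f q) / (\val r - \val q) @[r --> q^'] --> ddt_fun f q.
Proof.
move=> sf; have [_ [s _ <-] dq] := itv_atlas_cover q.
have [V [g [oV Vq sg fg]]] := sf (itv_chart a b s) (imageT _ s) q dq.
rewrite (ddt_chartE ab oV (sg 1) fg dq Vq).
exact: (ddt_chart_cvg (ab := ab) oV (sg 1) fg dq Vq).
Qed.

Lemma ddt_smooth (f : Cinf I) : smooth_fun (ddt_fun f).
Proof.
have [ab|ab] := boolP (a < b); last first.
  rewrite (_ : ddt_fun f = cst 0); first exact: smooth_fun_cst.
  by apply/funext => q; rewrite /ddt_fun (negbTE ab).
move=> _ [s _ <-] p dp.
have [V [g [oV Vp sg fg]]] := Cinf_smooth f (imageT _ s) dp.
exists V, (cst (sgn s) \* 'D_(delta_mx 0 (itv_dim_ord ab)) g); split=> //.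
  move=> k; apply: CkM oV (Ck_cst _ _ _) _.
  by case: (sg k.+1) => _ _; apply.
by move=> q dq _ Vq; rewrite (ddt_chartE ab oV (sg 1) fg dq Vq).
Qed.

Let dnbhs_cvg_eq (f g : I -> R) (q : I) (l : R) :
  f =1 g -> f r @[r --> q^'] --> l -> g r @[r --> q^'] --> l.
Proof. by move=> /funext ->. Qed.

Lemma ddtD (q : I) (f g : Cinf I) :
  ddt_fun (Cinf_add f g) q = ddt_fun f q + ddt_fun g q.
Proof.
have [ab|ab] := boolP (a < b); last by rewrite /ddt_fun (negbTE ab) addr0.
have PF := itv_dnbhs_proper ab q.
rewrite {1}/ddt_fun ab; refine (cvg_lim (@Rhausdorff R) _).
have H := cvgD (ddt_cvg ab (q := q) (Cinf_smooth f)) (ddt_cvg ab (q := q) (Cinf_smooth g)).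
refine (dnbhs_cvg_eq _ (H _)) => r.
by rewrite /=; ring.
Qed.

Lemma ddtZ (q : I) (x : R) (f : Cinf I) :
  ddt_fun (Cinf_scale x f) q = x * ddt_fun f q.
Proof.
have [ab|ab] := boolP (a < b); last by rewrite /ddt_fun (negbTE ab) mulr0.
have PF := itv_dnbhs_proper ab q.
rewrite {1}/ddt_fun ab; refine (cvg_lim (@Rhausdorff R) _).
have H := cvgM (cvg_cst x) (ddt_cvg ab (q := q) (Cinf_smooth f)).
refine (dnbhs_cvg_eq _ (H _ _)) => r.
by rewrite /=; ring.
Qed.

Lemma ddtM (q : I) (f g : Cinf I) :
  ddt_fun (Cinf_mul f g) q = f q * ddt_fun g q + g q * ddt_fun f q.
Proof.
have [ab|ab] := boolP (a < b); last first.
  by rewrite /ddt_fun (negbTE ab) !mulr0 addr0.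
have PF := itv_dnbhs_proper ab q.
rewrite {1}/ddt_fun ab; refine (cvg_lim (@Rhausdorff R) _).
have fq : f r @[r --> q^'] --> f q.
  by apply: cvg_within_filter; exact: (smooth_fun_cts (Cinf_smooth f)).
have H := cvgD (cvgM fq (ddt_cvg ab (q := q) (Cinf_smooth g)))
  (cvgM (cvg_cst (g q)) (ddt_cvg ab (q := q) (Cinf_smooth f))).
refine (dnbhs_cvg_eq _ (H _ _ _ _)) => r.
by rewrite /=; ring.
Qed.

(* At a point of a degenerate interval the tangent space is 0. *)
Definition ddt : vector_field I := VectorField
  (vf_at := fun q => Tangent (ddtD q) (ddtZ q) (ddtM q)) ddt_smooth.

End Ddt.

(** * Hybrid phase spaces and hybrid dynamical systems *)

Record graph := Graph {
  nodes : Type;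
  arrows : Type;
  src : arrows -> nodes;
  tgt : arrows -> nodes
}.

Definition is_graph_map (A B : graph) (f0 : nodes A -> nodes B)
    (f1 : arrows A -> arrows B) : Prop :=
  forall e, src (f1 e) = f0 (src e) /\ tgt (f1 e) = f0 (tgt e).

Record graph_map (A B : graph) := GraphMap {
  gm0 :> nodes A -> nodes B;
  gm1 : arrows A -> arrows B;
  gmP : is_graph_map gm0 gm1
}.

Record relation_arrow (R : realType) := RelationArrow {
  rel_src : region R;
  rel_tgt : region R;
  rel_set : set (rel_tgt * rel_src)
}.

Definition RR (R : realType) : graph :=
  Graph (@rel_src R) (@rel_tgt R).

(* [(y, x)] belongs to the relation [r], which goes from [P] to [Q].  The ends
   of [r] are only propositionally equal to [P] and [Q]. *)
Definition in_relation (R : realType) (r : arrows (RR R)) (P Q : region R)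
    (y : Q) (x : P) : Prop :=
  exists2 S : set (Q * P), r = RelationArrow S & S (y, x).

Notation hybrid_phase_space R A := (graph_map A (RR R)).

Record is_hps_map (R : realType) (A B : graph) (H : hybrid_phase_space R A)
    (K : hybrid_phase_space R B) (phi0 : nodes A -> nodes B)
    (phi1 : arrows A -> arrows B) (alpha : forall a, H a -> K (phi0 a)) : Prop :=
  IsHpsMap {
    hps_map_graph : is_graph_map phi0 phi1;
    hps_map_smooth : forall a, smooth_map (alpha a);
    hps_map_rel : forall (e : arrows A) (y : H (tgt e)) (x : H (src e)),
      in_relation (gm1 H e) y x ->
      in_relation (gm1 K (phi1 e)) (alpha (tgt e) y) (alpha (src e) x)
  }.

Arguments is_hps_map {R A B} H K phi0 phi1 alpha.

Record hybrid_system (R : realType) (A : graph) := HybridSystem {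
  hs_space :> hybrid_phase_space R A;
  hs_field : forall a, vector_field (hs_space a)
}.

(* A map of hybrid phase spaces that intertwines the vector fields at the nodes
   in [D].  Maps of hybrid dynamical systems are the case where [D] is
   everything; out of the system of a sequence of jump times, the condition is
   dropped at the nodes whose interval is degenerate. *)
Definition is_hds_map_on (R : realType) (A B : graph) (D : nodes A -> Prop)
    (X : hybrid_system R A) (Y : hybrid_system R B)
    (phi0 : nodes A -> nodes B) (phi1 : arrows A -> arrows B)
    (alpha : forall a, X a -> Y (phi0 a)) : Prop :=
  is_hps_map X Y phi0 phi1 alpha /\
  forall a, D a -> exists salpha : smooth_map (alpha a),
    forall p, hs_field Y (phi0 a) (alpha a p) =
              differential salpha (hs_field X a p).

Arguments is_hds_map_on {R A B} D X Y phi0 phi1 alpha.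

Definition is_hds_map (R : realType) (A B : graph)
    (X : hybrid_system R A) (Y : hybrid_system R B)
    (phi0 : nodes A -> nodes B) (phi1 : arrows A -> arrows B)
    (alpha : forall a, X a -> Y (phi0 a)) : Prop :=
  is_hds_map_on (fun=> True) X Y phi0 phi1 alpha.
Arguments is_hds_map {R A B} X Y phi0 phi1 alpha.

(** * Executions *)

Record jump_times (R : realType) := JumpTimes {
  jt :> nat -> R;
  jt_init : R; (* t_{-1} *)
  jt_nondecreasing : nondecreasing_seq jt;
  jt_init_lt : jt_init < jt 0
}.

Section JumpTimes.
Context {R : realType}.
Variable t : jump_times R.

(* t_{i-1} *)
Definition jt_prev (i : nat) : R := if i is j.+1 then t j else jt_init t.

Lemma jt_prev_le i : jt_prev i <= t i.
Proof. by case: i => [|i]; [exact/ltW/jt_init_lt|exact: jt_nondecreasing]. Qed.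

(* the region [t_{i-1}, t_i] and its end points *)
Definition jt_itv (i : nat) : region R := itv_region (jt_prev i) (t i).

Lemma jt_left_subproof i : jt_prev i <= jt_prev i <= t i.
Proof. by rewrite lexx jt_prev_le. Qed.

Lemma jt_right_subproof i : jt_prev i <= t i <= t i.
Proof. by rewrite lexx jt_prev_le. Qed.

Definition jt_left (i : nat) : jt_itv i := itv_point (jt_left_subproof i).

Definition jt_right (i : nat) : jt_itv i := itv_point (jt_right_subproof i).

Definition time_graph : graph := Graph (@id nat) S.

(* The left end point of [t_i, t_{i+1}] is t_i. *)
Definition time_relation (i : nat) : arrows (RR R) :=
  RelationArrow [set (jt_left i.+1, jt_right i)].

Lemma time_graph_map : is_graph_map (A := time_graph) (B := RR R)
  jt_itv time_relation.
Proof. by []. Qed.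

Definition time_phase_space : hybrid_phase_space R time_graph :=
  GraphMap time_graph_map.

Definition time_system : hybrid_system R time_graph :=
  HybridSystem (hs_space := time_phase_space)
    (fun i => ddt (jt_prev i) (t i)).

End JumpTimes.

(* Any map from a one-point interval is an integral curve. *)
Definition integral_curve (R : realType) (M : region R) (X : vector_field M)
    (a b : R) (x : itv_region a b -> M) : Prop :=
  a < b -> exists sx : smooth_map x,
    forall s, differential sx (ddt a b s) = X (x s).

Record execution (R : realType) (A : graph) (X : hybrid_system R A) :=
  Execution {
    ex_times : jump_times R;
    ex_node : nat -> nodes A;
    ex_arrow : nat -> arrows A;
    ex_src : forall i, src (ex_arrow i) = ex_node i;
    ex_tgt : forall i, tgt (ex_arrow i) = ex_node i.+1;
    ex_curve : forall i, jt_itv ex_times i -> X (ex_node i);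
    ex_integral : forall i,
      integral_curve (hs_field X (ex_node i)) (@ex_curve i);
    ex_jump : forall i,
      in_relation (gm1 X (ex_arrow i))
        (ex_curve (jt_left ex_times i.+1)) (ex_curve (jt_right ex_times i))
  }.
Arguments ex_times {R A X} e.
Arguments ex_node {R A X} e i.
Arguments ex_arrow {R A X} e i.
Arguments ex_src {R A X} e i.
Arguments ex_tgt {R A X} e i.
Arguments ex_curve {R A X} e i _.
Arguments ex_integral {R A X} e i _.
Arguments ex_jump {R A X} e i.

(* Main.v *)
Require Import Defs.
From mathcomp Require Import all_boot all_order all_algebra.
From mathcomp Require Import all_classical all_reals all_analysis.
From Stdlib Require Import Eqdep.
Import Order.TTheory.
Local Open Scope ring_scope.

(** Everything is part of the definition of an execution except for two points:
    the curves over degenerate intervals are smooth because any function on a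
    one-point region is, and the relation attached to the arrow [i] of the time
    graph holds only at the pair [(t_i, t_i)], where condition (5) of an
    execution applies. *)

Lemma smooth_fun_itv_degenerate (R : realType) (a b : R)
    (f : itv_region a b -> R) : ~~ (a < b) -> smooth_fun f.
Proof.
move=> ab c _ p _; exists setT, (cst (f p)); split=> //; first exact: openT.
- by move=> k; exact: Ck_cst.
(* Since [b <= a], the chain [q <= b <= a <= p] and its mirror image force [q = p]. *)
- move=> q _ _ _ /=; congr f; apply: val_inj; apply/le_anti.
  have /andP[aq qb] := itv_spaceP q; have /andP[ap pb] := itv_spaceP p.
  move: ab; rewrite -leNgt => ba.
  by rewrite (le_trans qb (le_trans ba ap)) (le_trans pb (le_trans ba aq)).
Qed.

(** [integral_curve] is vacuous unless [a < b], hence the case split. *)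
Lemma integral_curve_smooth (R : realType) (M : region R) (X : vector_field M)
    (a b : R) (x : itv_region a b -> M) : integral_curve X x -> smooth_map x.
Proof.
have [ab /(_ ab)[] //|ab _ g _] := boolP (a < b).
exact: smooth_fun_itv_degenerate.
Qed.

(** Injection only equates dependent pairs nested over the two end regions; [inj_pair2] strips each
    layer. *)
Lemma in_relationE (R : realType) (P Q : region R) (S : set (Q * P))
    (y : Q) (x : P) : in_relation (RelationArrow S) y x -> S (y, x).
Proof.
move=> [S' [SS'] S'yx].
by rewrite (inj_pair2 _ _ _ _ _ (inj_pair2 _ _ _ _ _ SS')).
Qed.

Theorem proposition4p5 (R : realType) (A : graph) (X : hybrid_system R A)
    (E : execution X) :
  is_hds_map_on (fun i : nodes time_graph => jt_prev (ex_times E) i < ex_times E i)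
    (time_system (ex_times E)) X (ex_node E) (ex_arrow E) (ex_curve E).
Proof.
split; first split.
- by move=> i; split; [exact: ex_src|exact: ex_tgt].
- by move=> i; exact: integral_curve_smooth (ex_integral E i).
- by move=> i y x /in_relationE[-> ->]; exact: ex_jump.
- by move=> i /(ex_integral E i)[sx sxE]; exists sx => p; rewrite -sxE.
Qed.
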